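(* Let $x^{(k)}$ be the ISRA iteration for the data $y\in\mathbb{R}^N$ and let $\tau$ be a fixed positive number. Consider the constrained backprojected residual (CBR) criterion for Gaussian noise of variance $\sigma^2$: choose the first iteration $k$ such that $$\| x^{(k)}\, H^T ( Hx^{(k)} - y ) \|^2 \;\le\; \tau\sum_{j=1}^M (x_j^{(k)})^2\, (H_2^T\sigma^2)_j ,\qquad (H_2)_{ij}=(H_{ij})^2 .$$ Then ISRA supplied with the CBR criterion becomes a well-defined regularization method. No restriction is placed on the input data $y$.
   Context: $H\in\mathbb{R}^{N\times M}$ is a matrix with $H_{ij}>0$ for all $i,j$. Products and quotients of vectors are taken componentwise, and $\|\cdot\|$ is the Euclidean norm. In $H_2^T\sigma^2$ the symbol $\sigma^2$ stands for the vector of $\mathbb{R}^N$ with all components equal to $\sigma^2$, so $(H_2^T\sigma^2)_j=\sigma^2\sum_{i=1}^N H_{ij}^2$. Let $\mathcal{C}=\{x\in\mathbb{R}^M : x_j\ge 0\ \forall j\}$. Gaussian model: the data are independent Gaussian variables with mean $Hx$ and variance $\sigma^2$. The constrained maximum likelihood (ML) problem, i.e. maximizing the likelihood over $x\in\mathcal{C}$, is then equivalent to minimizing $D_{LS}(y,x)=\|Hx-y\|^2$ over $x\in\mathcal{C}$. ISRA (Iterative Space Reconstruction Algorithm) is the iteration $x^{(k+1)} = x^{(k)}\,\dfrac{H^Ty}{H^THx^{(k)}}$ from an initialization $x^{(0)}$. It is taken as known that ISRA converges to the constrained minimum of $D_{LS}$. Definition (regularization for a constrained ML problem). The coefficient of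 variation of a random variable with mean $\mu$ and standard deviation $\sigma$ is $\delta=\sigma/\mu$. Let $y_\delta=\mathcal N_\sigma(Hx)$ denote a realization of a random variable with mean $\mu=Hx$ and coefficient of variation $\delta$, let $\mathcal L(x,y_\delta)$ be the associated likelihood, and let $\mathcal C$ be a convex subset of $\mathbb{R}^M$. An operator $R_\alpha:\Omega\subset\mathbb{R}^N\to\mathbb{R}^M$ is a regularizing operator for the constrained ML problem $\arg\max_{x\in\mathcal C}\mathcal L(x,y_\delta)$ if: 1) $R_\alpha$ is defined on the range of $H$; 2) there exists a function $\alpha=\alpha(\delta)$ such that, when the coefficient of variation tends to zero, $R_{\alpha(\delta)}(y_\delta)$ tends to a constrained solution $\hat x$ of the problem, i.e. $\lim_{\delta\to0}R_{\alpha(\delta)}(y_\delta)=\hat x$. In the case of iterative methods, when an algorithm $x^{(k)}$ converges to a constrained ML solution $\hat x$, condition 2) can be restated as 2a) there exists a function $k=k(\delta)$ such that $\lim_{\delta\to0}k(\delta)=\infty$. For an iterative method supplied with a stopping rule, the iteration number plays the role of the parameter $\alpha$ and $k(\delta)$ is the iteration selected by the rule. In the Gaussian case $\delta\to0$ if and only if $\sigma\to0$.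
   Formalization: k(δ)→∞ (2a) is claimed only if ISRA never becomes stationary (false otherwise: for M=1, x^(1) is exact); condition 2 is proved for every fixed y for which ISRA converges to the constrained minimum. For noisy data tending to Hx, the limit is the set of constrained solutions. *)

(* Defs.v *)
From HB Require Import structures.
From mathcomp Require Import all_boot all_order all_algebra.
From mathcomp Require Import all_classical all_reals all_analysis.

Set Implicit Arguments.
Unset Strict Implicit.
Unset Printing Implicit Defensive.

Import Order.TTheory GRing.Theory Num.Theory.
Import numFieldNormedType.Exports.

Local Open Scope classical_set_scope.
Local Open Scope ring_scope.

Section Vectors.
Variables (R : realType) (n : nat).
Implicit Types u v : 'cV[R]_n.

(* MathComp-Analysis norms matrices with the sup norm. *)
Definition norm2 v : R := Num.sqrt (\sum_i v i 0 ^+ 2).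

Definition vmul u v : 'cV[R]_n := \col_i (u i 0 * v i 0).

(* Total division: a / 0 = 0. *)
Definition vdiv u v : 'cV[R]_n := \col_i (u i 0 / v i 0).

Definition nonneg : set 'cV[R]_n := [set v | forall i, 0 <= v i 0].

End Vectors.

Section GaussianModel.
Variables (R : realType) (N M : nat) (H : 'M[R]_(N, M)).
Implicit Types (x : 'cV[R]_M) (y : 'cV[R]_N) (sigma : R).

(* [normal_pdf m s] takes the standard deviation s, not the variance. *)
Definition likelihood sigma x y : R :=
  \prod_i normal_pdf ((H *m x) i 0) sigma (y i 0).

(* The maximizers over the cone do not depend on sigma > 0, so quantifying
   over all noise levels is the same as fixing one. *)
Definition constrained_ML y : set 'cV[R]_M :=
  [set xhat | nonneg xhat /\ forall sigma x, 0 < sigma -> nonneg x ->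
    likelihood sigma x y <= likelihood sigma xhat y].

Definition D_LS y x : R := norm2 (H *m x - y) ^+ 2.

Definition constrained_LS y : set 'cV[R]_M :=
  [set xhat | nonneg xhat /\ forall x, nonneg x -> D_LS y xhat <= D_LS y x].

(* The iterate x^(k); x0 is the initialization. A component that vanishes
   stays equal to 0, whatever the denominator. *)
Fixpoint isra (x0 : 'cV[R]_M) y (k : nat) : 'cV[R]_M :=
  if k is k'.+1 then
    let x := isra x0 y k' in vmul x (vdiv (H^T *m y) (H^T *m (H *m x)))
  else x0.

Definition isra_converges (x0 : 'cV[R]_M) y : Prop :=
  exists2 xhat, constrained_LS y xhat & isra x0 y k @[k --> \oo] --> xhat.

Definition H_2 : 'M[R]_(N, M) := \matrix_(i, j) (H i j ^+ 2).

Definition CBR (tau sigma : R) y x : Prop :=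
  norm2 (vmul x (H^T *m (H *m x - y))) ^+ 2 <=
  tau * \sum_j (x j 0 ^+ 2 * (H_2^T *m const_mx (sigma ^+ 2) : 'cV[R]_M) j 0).

(* k is the first iteration, counting x^(0), that meets the criterion. *)
Definition CBR_selects (x0 : 'cV[R]_M) (tau sigma : R) y (k : nat) : Prop :=
  CBR tau sigma y (isra x0 y k) /\
  forall l, (l < k)%N -> ~ CBR tau sigma y (isra x0 y l).

End GaussianModel.

(* Regularization by an iterative method X (X y k is the k-th iterate for the
   data y) supplied with a stopping rule (rule sigma y k: at noise level sigma
   the rule selects iteration k); sol y is the set of constrained ML solutions
   for the data y. The coefficient of variation sigma / (H x)_i tends to 0 iff
   sigma does, so limits are taken as sigma tends to 0 from the right. *)
Section Regularization.
Variables (R : realType) (N M : nat).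
Variables (sol : 'cV[R]_N -> set 'cV[R]_M) (X : 'cV[R]_N -> nat -> 'cV[R]_M).
Variable rule : R -> 'cV[R]_N -> nat -> Prop.

(* If the method stops moving after finitely many steps (for instance ISRA
   with M = 1 gives the exact solution at k = 1), the selected iteration stays
   bounded as sigma tends to 0; otherwise it has to tend to infinity. *)
Definition never_stationary (y : 'cV[R]_N) : Prop :=
  forall n, X y n.+1 <> X y n.

Definition regularizes_fixed (y : 'cV[R]_N) (xhat : 'cV[R]_M) : Prop :=
  sol y xhat /\
  exists k : R -> nat,
    [/\ forall sigma, 0 < sigma -> rule sigma y (k sigma),
        X y (k sigma) @[sigma --> 0^'+] --> xhat
      & never_stationary y -> k sigma @[sigma --> 0^'+] --> \oo].

(* Data yd sigma of noise level sigma tending to the noise-free data y, such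
   as yd sigma = y + sigma *: e for a realization e of standard Gaussian noise.
   The second clause says that the selected iterates tend to the set sol y;
   when sol y is a singleton this is convergence to its element. *)
Definition regularizes_noisy (yd : R -> 'cV[R]_N) (y : 'cV[R]_N) : Prop :=
  exists k : R -> nat,
    [/\ \forall sigma \near 0^'+, rule sigma (yd sigma) (k sigma),
        forall U : set 'cV[R]_M, open U -> sol y `<=` U ->
          \forall sigma \near 0^'+, U (X (yd sigma) (k sigma))
      & never_stationary y -> k sigma @[sigma --> 0^'+] --> \oo].

End Regularization.

(* Main.v *)
(* At an iterate [x] the left-hand side of the CBR test is the squared norm of
   [x_j (H^T H x - H^T y)_j]. Where it vanishes, [x] is a fixed point of ISRA,
   hence equal to the limit; where it does not, the test fails for all small
   [sigma]. So either the selected index tends to infinity or the selected iterate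
   is already the limit. An index is always selected: passing to the limit in the
   recursion shows that the left-hand side tends to [0], while the right-hand side
   stays positive unless the limit is [0], which ISRA reaches only in finitely many
   steps.

   For noisy data, continuity controls finitely many iterates only. The remaining
   ones are controlled by the fact that ISRA does not increase [D_LS] when
   [H^T y > 0]: at the selected iterate [D_LS] is as small as wanted, the iterates stay in
   a fixed box, and compactness of the box turns small [D_LS] into closeness to the
   solution set. *)
Require Import Defs.
From HB Require Import structures.
From mathcomp Require Import all_boot all_order all_algebra.
From mathcomp Require Import all_classical all_reals all_analysis.
From mathcomp Require Import ring lra.

Set Implicit Arguments.
Unset Strict Implicit.
Unset Printing Implicit Defensive.

Import Order.TTheory GRing.Theory Num.Theory.
Import numFieldNormedType.Exports.

Local Open Scope classical_set_scope.
Local Open Scope ring_scope.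

(** * Compactness, entrywise limits of matrices, and the Euclidean norm *)

Section Topology.
Variables (R : realType).

(** On the compact set [K] minus [U] the function attains its minimum, which is positive by the last
    hypothesis; that minimum serves as [d]. This turns a small discrepancy into closeness to the
    solution set. *)
Lemma compact_sublevel (T : topologicalType) (K U : set T) (f : T -> R) :
  compact K -> open U -> continuous f ->
  (forall x, K x -> f x <= 0 -> U x) ->
  exists2 d, 0 < d & forall x, K x -> f x < d -> U x.
Proof.
move=> cK oU cf KU.
have cKU : compact (K `&` ~` U) by apply: compact_closedI => //; exact: open_closedC.
have [[x0 KUx0]|KU0] := pselect (K `&` ~` U !=set0); last first.
  exists 1 => // x Kx _; apply: contrapT => nUx; apply: KU0; by exists x.
have cfA : {within K `&` ~` U, continuous f} by exact: continuous_subspaceT.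
have [|c cKU' cmin] := compact_EVT_min _ cKU cfA; first by exists x0.
move: cKU' => /set_mem [Kc nUc].
have fc0 : 0 < f c by rewrite ltNge; apply/negP => /(KU _ Kc).
exists (f c) => // x Kx; rewrite ltNge => fx; apply: contrapT => nUx.
by move/negP: fx; apply; apply: cmin; apply/mem_set.
Qed.

Lemma cvg_mx_entries (S : Type) (F : set_system S) {FF : Filter F} (m n : nat)
    (f : S -> 'M[R]_(m, n)) (A : 'M[R]_(m, n)) :
  (forall i j, f t i j @[t --> F] --> A i j) -> f t @[t --> F] --> A.
Proof.
move=> fA B [P AP PB].
have : \forall t \near F, forall i j, P i j (f t i j).
  apply: filter_forall => i.
  by apply: filter_forall => j; exact/fA/AP.
by apply: filterS => t Pt; apply: PB.
Qed.

Lemma cvg_mx_entry (S : Type) (F : set_system S) {FF : Filter F} (m n : nat)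
    (f : S -> 'M[R]_(m, n)) (A : 'M[R]_(m, n)) i j :
  f t @[t --> F] --> A -> f t i j @[t --> F] --> A i j.
Proof.
by move=> fA; exact: (cvg_comp f (fun B : 'M[R]_(m, n) => B i j) fA
  (@coord_continuous _ _ _ i j A)).
Qed.

Lemma cV_box_compact (n : nat) (b : 'I_n -> R) :
  compact [set v : 'cV[R]_n | forall i, 0 <= v i 0 <= b i].
Proof.
have -> : [set v : 'cV[R]_n | forall i, 0 <= v i 0 <= b i] =
    trmx @` [set v : 'rV[R]_n | forall i, `[0, b i]%classic (v 0 i)].
  apply/seteqP; split=> [v vb|_ [v vb <-] i].
    by exists v^T; [move=> i /=; rewrite mxE in_itv /= vb|rewrite trmxK].
  by have := vb i; rewrite mxE /= in_itv.
apply: continuous_compact; last first.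
  by apply: (@rV_compact _ _ (fun i => `[0, b i]%classic)) => i; exact: segment_compact.
apply: continuous_subspaceT => v.
apply: (@cvg_mx_entries _ (nbhs v)) => i j; rewrite mxE.
under eq_fun do rewrite mxE.
exact: coord_continuous.
Qed.

Lemma cvg_sumr (S : Type) (F : set_system S) {FF : Filter F} (I : finType)
    (f : I -> S -> R) (a : I -> R) :
  (forall i, f i t @[t --> F] --> a i) ->
  \sum_i f i t @[t --> F] --> \sum_i a i.
Proof. by move=> fa; apply: cvg_big => //; exact: add_continuous. Qed.

Lemma cvg_mulmx (S : Type) (F : set_system S) {FF : Filter F} (m n : nat)
    (B : 'M[R]_(m, n)) (f : S -> 'cV[R]_n) (v : 'cV[R]_n) :
  f t @[t --> F] --> v -> B *m f t @[t --> F] --> B *m v.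
Proof.
move=> fv; apply: cvg_mx_entries => i j; rewrite mxE.
under eq_fun do rewrite mxE.
apply: cvg_sumr => k; apply: cvgM; first exact: cvg_cst.
exact: cvg_mx_entry.
Qed.

Lemma cvg_vmul (S : Type) (F : set_system S) {FF : Filter F} (n : nat)
    (f g : S -> 'cV[R]_n) (u v : 'cV[R]_n) :
  f t @[t --> F] --> u -> g t @[t --> F] --> v ->
  vmul (f t) (g t) @[t --> F] --> vmul u v.
Proof.
move=> fu gv; apply: cvg_mx_entries => i j; rewrite mxE.
under eq_fun do rewrite mxE.
by apply: cvgM; exact: cvg_mx_entry.
Qed.

Lemma cvg_vdiv (S : Type) (F : set_system S) {FF : Filter F} (n : nat)
    (f g : S -> 'cV[R]_n) (u v : 'cV[R]_n) :
  (forall i, v i 0 != 0) ->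
  f t @[t --> F] --> u -> g t @[t --> F] --> v ->
  vdiv (f t) (g t) @[t --> F] --> vdiv u v.
Proof.
move=> v0 fu gv; apply: cvg_mx_entries => i j; rewrite mxE.
under eq_fun do rewrite mxE.
by apply: cvgM; [|apply: cvgV => //]; exact: cvg_mx_entry.
Qed.

Lemma norm2_sqr (n : nat) (v : 'cV[R]_n) : norm2 v ^+ 2 = \sum_i v i 0 ^+ 2.
Proof. by rewrite sqr_sqrtr // sumr_ge0 // => i _; rewrite sqr_ge0. Qed.

Lemma norm2_0 (n : nat) : norm2 (0 : 'cV[R]_n) = 0.
Proof.
by apply/eqP; rewrite -sqrf_eq0 norm2_sqr big1 // => i _; rewrite mxE expr0n.
Qed.

Lemma cvg_norm2_sqr (S : Type) (F : set_system S) {FF : Filter F} (n : nat)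
    (f : S -> 'cV[R]_n) (v : 'cV[R]_n) :
  f t @[t --> F] --> v -> norm2 (f t) ^+ 2 @[t --> F] --> norm2 v ^+ 2.
Proof.
move=> fv; rewrite norm2_sqr; under eq_fun do rewrite norm2_sqr.
by apply: cvg_sumr => i; apply: cvgM; exact: cvg_mx_entry.
Qed.

End Topology.

(** * Gaussian likelihood, the CBR test with [sigma] isolated, and continuity *)

Section Isra.
Variables (R : realType) (N M : nat) (H : 'M[R]_(N, M)).
Implicit Types (x z : 'cV[R]_M) (y : 'cV[R]_N).

Lemma likelihoodE (sigma : R) x y : 0 < sigma ->
  likelihood H sigma x y =
  normal_peak sigma ^+ N * expR (- (D_LS H y x / (sigma ^+ 2 *+ 2))).
Proof.
move=> s0; rewrite /likelihood.
under eq_bigr do rewrite normal_pdfE ?gt_eqF//.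
rewrite big_split /= prodr_const card_ord; congr (_ * _).
rewrite /D_LS norm2_sqr /normal_fun -expR_sum; congr expR.
rewrite mulr_suml -sumrN; apply: eq_bigr => i _.
by rewrite mulNr !mxE -sqrrN opprB.
Qed.

(** For each [sigma > 0] the likelihood is a nonnegative constant times a decreasing function of
    [D_LS]. *)
Lemma constrained_LS_ML y : constrained_LS H y `<=` constrained_ML H y.
Proof.
move=> x [x0 xmin]; split=> // sigma z s0 z0.
rewrite !likelihoodE // ler_wpM2l ?exprn_ge0 ?normal_peak_ge0 //.
by rewrite ler_expR lerN2 ler_pM2r ?xmin // invr_gt0 pmulrn_lgt0 // exprn_gt0.
Qed.

Definition cbr_residual y x : R := norm2 (vmul x (H^T *m (H *m x - y))) ^+ 2.

Definition cbr_noise x : R := \sum_j x j 0 ^+ 2 * (\sum_i H i j ^+ 2).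

Lemma CBRE tau sigma y x :
  CBR H tau sigma y x <->
  cbr_residual y x <= tau * sigma ^+ 2 * cbr_noise x.
Proof.
rewrite /CBR -/(cbr_residual y x) -mulrA [in X in _ <-> X]mulr_sumr.
suff -> : \sum_j x j 0 ^+ 2 *
    (((H_2 H)^T *m const_mx (sigma ^+ 2) : 'cV[R]_M) j 0) =
    \sum_j sigma ^+ 2 * (x j 0 ^+ 2 * \sum_i H i j ^+ 2) by [].
apply: eq_bigr => j _; rewrite mulrCA; congr (_ * _).
rewrite mxE mulr_sumr; apply: eq_bigr => i _.
by rewrite !mxE mulrC.
Qed.

Lemma cbr_residual_ge0 y x : 0 <= cbr_residual y x.
Proof. by rewrite sqr_ge0. Qed.

Lemma cbr_residual_eq0 y x : cbr_residual y x = 0 ->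
  forall j, x j 0 = 0 \/ (H^T *m (H *m x)) j 0 = (H^T *m y) j 0.
Proof.
rewrite /cbr_residual norm2_sqr => /eqP.
rewrite psumr_eq0 => [/allP r0 j|i _]; last exact: sqr_ge0.
have /= := r0 j (mem_index_enum j).
rewrite sqrf_eq0 mxE mulf_eq0 mulmxBr => /orP[/eqP|]; first by left.
by rewrite mxE [X in _ + X]mxE subr_eq0 => /eqP; right.
Qed.

Lemma israS x0 y k j : isra H x0 y k.+1 j 0 =
  isra H x0 y k j 0 *
  ((H^T *m y) j 0 / (H^T *m (H *m isra H x0 y k)) j 0).
Proof. by rewrite /= !mxE. Qed.

Lemma isra_stationary x0 y n m : isra H x0 y n.+1 = isra H x0 y n ->
  (n <= m)%N -> isra H x0 y m = isra H x0 y n.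
Proof.
move=> st; elim: m => [|m IH]; first by rewrite leqn0 => /eqP->.
rewrite leq_eqVlt => /predU1P[-> //|]; rewrite ltnS => nm.
by rewrite -[RHS]st /= IH.
Qed.

Lemma D_LS_ge0 y x : 0 <= D_LS H y x.
Proof. exact: sqr_ge0. Qed.

Section Convergence.
Context (S : Type) (F : set_system S) {FF : Filter F}.

Lemma cvg_D_LS (g : S -> 'cV[R]_N) (f : S -> 'cV[R]_M) y x :
  g t @[t --> F] --> y -> f t @[t --> F] --> x ->
  D_LS H (g t) (f t) @[t --> F] --> D_LS H y x.
Proof.
by move=> gy fx; apply: cvg_norm2_sqr; apply: cvgB => //; exact: cvg_mulmx.
Qed.

Lemma cvg_cbr_residual (g : S -> 'cV[R]_N) (f : S -> 'cV[R]_M) y x :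
  g t @[t --> F] --> y -> f t @[t --> F] --> x ->
  cbr_residual (g t) (f t) @[t --> F] --> cbr_residual y x.
Proof.
move=> gy fx; apply: cvg_norm2_sqr; apply: cvg_vmul => //.
by apply: cvg_mulmx; apply: cvgB => //; exact: cvg_mulmx.
Qed.

Lemma cvg_cbr_noise (f : S -> 'cV[R]_M) x :
  f t @[t --> F] --> x -> cbr_noise (f t) @[t --> F] --> cbr_noise x.
Proof.
move=> fx; apply: cvg_sumr => j; apply: cvgM; last exact: cvg_cst.
by apply: cvgM; exact: cvg_mx_entry.
Qed.

End Convergence.

End Isra.

(** * Positivity of the quantities formed from [H] *)

Section Positive.
Variables (R : realType) (N M : nat) (H : 'M[R]_(N, M)).
Hypotheses (N_gt0 : (0 < N)%N) (H_gt0 : forall i j, 0 < H i j).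
Implicit Types (x z : 'cV[R]_M) (y : 'cV[R]_N).

Lemma nonneg_gt0 n (x : 'cV[R]_n) : nonneg x -> x <> 0 -> exists j, 0 < x j 0.
Proof.
move=> x0 /eqP/matrix0Pn[j [k]]; rewrite ord1 => xj.
by exists j; rewrite lt_neqAle eq_sym xj x0.
Qed.

Lemma mulmx_gt0 x i : nonneg x -> x <> 0 -> 0 < (H *m x) i 0.
Proof.
move=> x0 /(nonneg_gt0 x0)[j xj]; rewrite mxE (bigD1 j) //=.
rewrite ltr_pwDl ?mulr_gt0 // sumr_ge0 // => k _.
by rewrite mulr_ge0 ?x0 // ltW.
Qed.

Lemma trmx_mulmx_gt0 y j : (forall i, 0 < y i 0) -> 0 < (H^T *m y) j 0.
Proof.
move=> y0; rewrite mxE (bigD1 (Ordinal N_gt0)) //= mxE.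
rewrite ltr_pwDl ?mulr_gt0 // sumr_ge0 // => k _.
by rewrite mxE mulr_ge0 ?ltW.
Qed.

Lemma normal_mx_gt0 x j : nonneg x -> x <> 0 -> 0 < (H^T *m (H *m x)) j 0.
Proof. by move=> x0 xN0; apply: trmx_mulmx_gt0 => i; exact: mulmx_gt0. Qed.

Lemma sqr_col_gt0 j : 0 < \sum_i H i j ^+ 2.
Proof.
rewrite (bigD1 (Ordinal N_gt0)) //= ltr_pwDl ?exprn_gt0 // sumr_ge0 // => k _.
exact: sqr_ge0.
Qed.

Lemma cbr_noise_ge0 x : 0 <= cbr_noise H x.
Proof. by apply: sumr_ge0 => j _; rewrite mulr_ge0 ?sqr_ge0 // ltW // sqr_col_gt0. Qed.

Lemma cbr_noise_gt0 x : nonneg x -> x <> 0 -> 0 < cbr_noise H x.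
Proof.
move=> x0 /(nonneg_gt0 x0)[j xj]; rewrite /cbr_noise (bigD1 j) //=.
rewrite ltr_pwDl ?mulr_gt0 ?exprn_gt0 ?sqr_col_gt0 // sumr_ge0 // => k _.
by rewrite mulr_ge0 ?sqr_ge0 // ltW // sqr_col_gt0.
Qed.

(** * Fixed points and limits of ISRA *)

Section Iterates.
Variables (x0 : 'cV[R]_M) (x0_ge0 : nonneg x0).

(* Since [0 / 0 = 0], the equality [(H^T H x)_j = (H^T y)_j] fixes component [j]
   only if [(H^T y)_j != 0]. When [(H^T y)_j = 0], component [j] vanishes from the
   first step on, and at the start the equality fails because [(H^T H x0)_j > 0]. *)
Lemma cbr_residual_fixed y n : cbr_residual H y (isra H x0 y n) = 0 ->
  isra H x0 y n.+1 = isra H x0 y n.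
Proof.
move=> /cbr_residual_eq0 res0; apply/matrixP => j k; rewrite ord1 {k} israS.
have [->|xj] := eqVneq (isra H x0 y n j 0) 0; first by rewrite mul0r.
have [xj0|->] := res0 j; first by rewrite xj0 eqxx in xj.
have [aj|aj] := eqVneq ((H^T *m y) j 0) 0; last by rewrite divff ?mulr1.
exfalso; case: n res0 xj => [|n] res0 xj; last first.
  by move: xj; rewrite israS aj mul0r mulr0 eqxx.
have [/eqP|e] := res0 j; first by rewrite (negPf xj).
have : 0 < (H^T *m (H *m x0)) j 0.
  by apply: normal_mx_gt0 => // x00; move: xj; rewrite /= x00 mxE eqxx.
by rewrite e aj ltxx.
Qed.

Lemma cbr_residual_limit y n xhat : cbr_residual H y (isra H x0 y n) = 0 ->
  isra H x0 y k @[k --> \oo] --> xhat ->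
  forall m, (n <= m)%N -> isra H x0 y m = xhat.
Proof.
move=> /cbr_residual_fixed st cvg_xhat m nm.
rewrite (isra_stationary st nm).
apply/esym; apply: (@cvg_unique _ (@norm_hausdorff R _) _ _ _ _ cvg_xhat).
apply: cvg_near_cst; exists n => // k /= nk; exact: isra_stationary.
Qed.

(** This is the complementarity part of the Kuhn-Tucker conditions. It comes from the limit of the
    recursion: a nonzero nonnegative limit keeps the denominator away from [0], so division is
    continuous there. *)
Lemma isra_limit_stationary y xhat j : nonneg xhat ->
  isra H x0 y k @[k --> \oo] --> xhat ->
  xhat j 0 * ((H^T *m (H *m xhat)) j 0 - (H^T *m y) j 0) = 0.
Proof.
move=> xhat_ge0 cvg_xhat.
have [->|xhatN0] := eqVneq xhat 0; first by rewrite mxE mul0r.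
have Gxhat : 0 < (H^T *m (H *m xhat)) j 0 by apply: normal_mx_gt0 => //; exact/eqP.
have cvgx : isra H x0 y k j 0 @[k --> \oo] --> xhat j 0 by exact: cvg_mx_entry.
have cvgG : (H^T *m (H *m isra H x0 y k)) j 0 @[k --> \oo] -->
    (H^T *m (H *m xhat)) j 0.
  by apply: cvg_mx_entry; do 2 apply: cvg_mulmx.
have cvgS : isra H x0 y k.+1 j 0 @[k --> \oo] -->
    xhat j 0 * ((H^T *m y) j 0 / (H^T *m (H *m xhat)) j 0).
  under eq_fun do rewrite israS.
  apply: cvgM => //; apply: cvgM; first exact: cvg_cst.
  by apply: cvgV => //; rewrite gt_eqF.
have cvgS' : isra H x0 y k.+1 j 0 @[k --> \oo] --> xhat j 0.
  by rewrite (cvg_shiftS (fun k => isra H x0 y k j 0)).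
have e := cvg_unique (@norm_hausdorff _ R) cvgS cvgS'.
by rewrite mulrBr -{1}e -mulrA divfK ?gt_eqF // subrr.
Qed.

Lemma isra_zero_stable y n m j : isra H x0 y n j 0 = 0 -> (n <= m)%N ->
  isra H x0 y m j 0 = 0.
Proof.
move=> xn0; elim: m => [|m IH]; first by rewrite leqn0 => /eqP n0; rewrite n0 in xn0.
rewrite leq_eqVlt => /predU1P[<- //|]; rewrite ltnS => /IH xm0.
by rewrite israS xm0 mul0r.
Qed.

(* Near [0] the multiplicative factor [(H^T y)_j / (H^T H x)_j] blows up, so a
   component can only tend to [0] by vanishing exactly. *)
Lemma isra_limit0 y : isra H x0 y k @[k --> \oo] --> (0 : 'cV[R]_M) ->
  exists k, isra H x0 y k = 0.
Proof.
move=> cvg0.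
have vanish j : exists n, isra H x0 y n j 0 = 0.
  have [aj|aj] := eqVneq ((H^T *m y) j 0) 0.
    by exists 1%N; rewrite israS aj mul0r mulr0.
  apply/not_existsP => xN0.
  have cvgG : (H^T *m (H *m isra H x0 y k)) j 0 @[k --> \oo] --> (0 : R).
    have -> : 0 = (H^T *m (H *m (0 : 'cV[R]_M))) j 0 by rewrite !mulmx0 mxE.
    by apply: cvg_mx_entry; do 2 apply: cvg_mulmx.
  have cvgx : isra H x0 y k j 0 @[k --> \oo] --> (0 : R).
    by have -> : 0 = (0 : 'cV[R]_M) j 0; [rewrite mxE|exact: cvg_mx_entry].
  have aj0 : 0 < `|(H^T *m y) j 0| by rewrite normr_gt0.
  have [K _ GK] := cvgr0_norm_lt _ cvgG _ aj0.
  have grow k : `|isra H x0 y K j 0| <= `|isra H x0 y (k + K)%N j 0|.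
    elim: k => [//|k IH]; apply: (le_trans IH).
    have Gk := GK (k + K)%N (leq_addl k K).
    (* As [0^-1 = 0], a vanishing denominator would make the next component vanish, against
       [xN0]. *)
    have GN0 : (H^T *m (H *m isra H x0 y (k + K))) j 0 != 0.
      apply/eqP => G0; apply: (xN0 (k + K).+1).
      by rewrite israS G0 invr0 !mulr0.
    rewrite addSn israS normrM ler_peMr // normrM normfV.
    by rewrite ler_pdivlMr ?normr_gt0 // mul1r ltW.
  have xK0 : 0 < `|isra H x0 y K j 0| by rewrite normr_gt0; apply/eqP; exact: xN0.
  have [L _ xL] := cvgr0_norm_lt _ cvgx _ xK0.
  have /= := xL (L + K)%N (leq_addr K L).
  by rewrite ltNge grow.
have : \forall k \near \oo, forall j, isra H x0 y k j 0 = 0.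
  apply: filter_forall => j; have [n xn0] := vanish j.
  by exists n => // m /= nm; exact: isra_zero_stable xn0 nm.
move=> [k _ xk0]; exists k; apply/matrixP => j i; rewrite ord1 mxE.
exact: xk0 (leqnn k) j.
Qed.

(** * Existence of a selected iteration, and failure of the test at small noise *)

Lemma CBR_reached tau sigma y xhat : 0 < tau -> 0 < sigma -> nonneg xhat ->
  isra H x0 y k @[k --> \oo] --> xhat ->
  exists k, CBR H tau sigma y (isra H x0 y k).
Proof.
move=> tau0 sigma0 xhat_ge0 cvg_xhat.
have [xhat0|/eqP xhatN0] := eqVneq xhat 0.
  rewrite xhat0 in cvg_xhat; have [k xk0] := isra_limit0 cvg_xhat.
  (* At the zero iterate both sides of the test vanish, and the inequality is not strict. *)
  exists k; apply/CBRE; rewrite xk0 /cbr_residual.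
  have -> : vmul 0 (H^T *m (H *m 0 - y)) = 0.
    by apply/matrixP => j i; rewrite !mxE mul0r.
  by rewrite norm2_0 expr0n !mulr_ge0 ?sqr_ge0 ?cbr_noise_ge0 // ltW.
have res0 : cbr_residual H y xhat = 0.
  rewrite /cbr_residual norm2_sqr big1 // => j _.
  rewrite mxE mulmxBr mxE [X in _ + X]mxE isra_limit_stationary ?expr0n //.
have bnd0 : 0 < tau * sigma ^+ 2 * cbr_noise H xhat.
  by rewrite !mulr_gt0 ?exprn_gt0 // cbr_noise_gt0.
have cvg_diff : tau * sigma ^+ 2 * cbr_noise H (isra H x0 y k) -
    cbr_residual H y (isra H x0 y k) @[k --> \oo] -->
    tau * sigma ^+ 2 * cbr_noise H xhat - cbr_residual H y xhat.
  apply: cvgB; last by apply: cvg_cbr_residual => //; exact: cvg_cst.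
  by apply: cvgM; [exact: cvg_cst|exact: cvg_cbr_noise].
rewrite res0 subr0 in cvg_diff.
have [k _ hk] := cvgr_gt _ cvg_diff _ bnd0.
exists k; apply/CBRE; rewrite -subr_ge0 ltW //.
exact: hk (leqnn k).
Qed.

Lemma CBR_selects_ex tau sigma y xhat : 0 < tau -> 0 < sigma -> nonneg xhat ->
  isra H x0 y k @[k --> \oo] --> xhat ->
  exists k, CBR_selects H x0 tau sigma y k.
Proof.
move=> tau0 sigma0 xhat_ge0 /(CBR_reached tau0 sigma0 xhat_ge0)[k0 Pk0].
have exP : exists k, `[< CBR H tau sigma y (isra H x0 y k) >].
  by exists k0; exact/asboolP.
exists (ex_minn exP); case: ex_minnP => k /asboolP Pk kmin; split=> // l lk Pl.
by have := kmin l (asboolT Pl); rewrite leqNgt lk.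
Qed.

(** Letting the data vary with [sigma] serves both claims: a constant [yd] gives the case of fixed
    data. *)
Lemma CBR_fails_near tau y (yd : R -> 'cV[R]_N) l :
  yd sigma @[sigma --> 0^'+] --> y ->
  isra H x0 (yd sigma) l @[sigma --> 0^'+] --> isra H x0 y l ->
  cbr_residual H y (isra H x0 y l) <> 0 ->
  \forall sigma \near 0^'+,
    ~ CBR H tau sigma (yd sigma) (isra H x0 (yd sigma) l).
Proof.
move=> ydy xl res0.
have {}res0 : 0 < cbr_residual H y (isra H x0 y l).
  by rewrite lt_neqAle cbr_residual_ge0 eq_sym; move/eqP: res0 => ->.
have sigma2 : (fun sigma : R => sigma ^+ 2) @ 0^'+ --> (0 : R) ^+ 2.
  by apply: cvgM; apply: cvg_at_right_filter; exact: cvg_id.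
have cvg_diff : cbr_residual H (yd sigma) (isra H x0 (yd sigma) l) -
    tau * sigma ^+ 2 * cbr_noise H (isra H x0 (yd sigma) l) @[sigma --> 0^'+] -->
    cbr_residual H y (isra H x0 y l) -
    tau * 0 ^+ 2 * cbr_noise H (isra H x0 y l).
  apply: cvgB; first exact: cvg_cbr_residual.
  apply: cvgM; last exact: cvg_cbr_noise.
  by apply: cvgM => //; exact: cvg_cst.
rewrite expr0n mulr0 mul0r subr0 in cvg_diff.
apply: filterS (cvgr_gt _ cvg_diff _ res0) => sigma /=.
by rewrite subr_gt0 ltNge => /negP nP /CBRE.
Qed.

Lemma CBR_fails_before tau y (yd : R -> 'cV[R]_N) n :
  yd sigma @[sigma --> 0^'+] --> y ->
  (forall l, isra H x0 (yd sigma) l @[sigma --> 0^'+] --> isra H x0 y l) ->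
  \forall sigma \near 0^'+, forall l, (l < n)%N ->
    cbr_residual H y (isra H x0 y l) <> 0 ->
    ~ CBR H tau sigma (yd sigma) (isra H x0 (yd sigma) l).
Proof.
move=> ydy xl.
have : \forall sigma \near 0^'+, forall l : 'I_n,
    cbr_residual H y (isra H x0 y l) <> 0 ->
    ~ CBR H tau sigma (yd sigma) (isra H x0 (yd sigma) l).
  apply: filter_forall => l.
  have [r0|rN0] := pselect (cbr_residual H y (isra H x0 y l) = 0).
    by apply: nearW => sigma /(_ r0).
  by apply: filterS (CBR_fails_near tau ydy (xl l) rN0) => sigma nP _.
by apply: filterS => sigma nP l ln; exact: (nP (Ordinal ln)).
Qed.

(** * Sign, boundedness and continuous dependence on the data of the iterates *)

Lemma isra_ge0 y k : (forall j, 0 <= (H^T *m y) j 0) -> nonneg (isra H x0 y k).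
Proof.
move=> a0; elim: k => [|k IH] j; first exact: x0_ge0.
rewrite israS mulr_ge0 ?IH // divr_ge0 //.
have [->|/eqP xN0] := eqVneq (isra H x0 y k) 0; first by rewrite !mulmx0 mxE.
by rewrite ltW // normal_mx_gt0.
Qed.

Lemma isra_neq0 y k : x0 <> 0 -> (forall j, 0 < (H^T *m y) j 0) ->
  isra H x0 y k <> 0.
Proof.
move=> x0N0 a0; elim: k => [//|k IH].
have xk0 : nonneg (isra H x0 y k) by apply: isra_ge0 => j; exact: ltW.
have [j xj] := nonneg_gt0 xk0 IH.
move/matrixP => /(_ j 0); rewrite israS [RHS]mxE; apply/eqP.
by rewrite gt_eqF // mulr_gt0 // divr_gt0 // normal_mx_gt0.
Qed.

(** Keeping only the diagonal term gives [(H^T H x)_j >= x_j sum_i H_ij^2], so every iterate after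
    the first is at most the quotient; the summand [x0 j 0] covers [k = 0]. *)
Lemma isra_bound y k j : (forall j, 0 <= (H^T *m y) j 0) ->
  isra H x0 y k j 0 <= x0 j 0 + (H^T *m y) j 0 / \sum_i H i j ^+ 2.
Proof.
move=> a0; have c0 := sqr_col_gt0 j.
case: k => [|k]; first by rewrite /= lerDl divr_ge0 // ltW.
rewrite israS; apply: (@le_trans _ _ ((H^T *m y) j 0 / \sum_i H i j ^+ 2)); last first.
  by rewrite lerDr x0_ge0.
set x := isra H x0 y k; have xge0 : nonneg x by exact: isra_ge0.
have [->|/eqP xN0] := eqVneq x 0; first by rewrite mxE mul0r divr_ge0 // ltW.
have G0 := normal_mx_gt0 j xge0 xN0.
rewrite mulrCA ler_wpM2l // ler_pdivrMr // ler_pdivlMl //.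
rewrite !mxE mulr_suml; apply: ler_sum => i _.
rewrite expr2 -mulrA !mxE ler_wpM2l ?(ltW (H_gt0 _ _)) // (bigD1 j) //= lerDl.
by rewrite sumr_ge0 // => l _; rewrite mulr_ge0 ?xge0 // ltW.
Qed.

(** The denominators at the limit data are positive because the iterates there stay nonnegative and
    nonzero, so each step is continuous. *)
Lemma cvg_isra (S : Type) (F : set_system S) {FF : Filter F}
    (yd : S -> 'cV[R]_N) y k :
  x0 <> 0 -> (forall j, 0 < (H^T *m y) j 0) ->
  yd t @[t --> F] --> y -> isra H x0 (yd t) k @[t --> F] --> isra H x0 y k.
Proof.
move=> x0N0 a0 ydy; elim: k => [|k IH]; first exact: cvg_cst.
apply: cvg_vmul => //; apply: cvg_vdiv.
- move=> j; rewrite gt_eqF // normal_mx_gt0 //; last exact: isra_neq0.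
  by apply: isra_ge0 => i; exact: ltW.
- exact: cvg_mulmx.
- by do 2 apply: cvg_mulmx.
Qed.

End Iterates.

(** * Monotone decrease of the least-squares discrepancy *)

Lemma sqr_wmean_le (n : nat) (w s : 'I_n -> R) : (forall j, 0 <= w j) ->
  (\sum_j w j * s j) ^+ 2 <= (\sum_j w j) * (\sum_j w j * s j ^+ 2).
Proof.
(* Doubling symmetrizes the gap: it becomes the double sum of [w_j w_k (s_j - s_k)^2]. *)
move=> w0; rewrite -(ler_pM2l (ltr0Sn R 1)) [X in _ <= X]mulr_natl mulr2n.
rewrite [X in _ <= _ + X]mulrC expr2 !big_distrlr /= -big_split mulr_sumr /=.
apply: ler_sum => j _; rewrite -big_split mulr_sumr /=; apply: ler_sum => k _.
rewrite -subr_ge0.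
suff -> : w j * (w k * s k ^+ 2) + w j * s j ^+ 2 * w k -
    2 * (w j * s j * (w k * s k)) = w j * w k * (s j - s k) ^+ 2.
  by rewrite mulr_ge0 ?sqr_ge0 // mulr_ge0.
by ring.
Qed.

(* With [d_j = x_j s_j] the increment, the linear part of the change of [D_LS]
   is [-2 sum_j x_j (H^T H x)_j s_j^2], and by the weighted Jensen inequality
   the quadratic part [|H d|^2] is at most [sum_j x_j (H^T H x)_j s_j^2]. *)
Lemma isra_descent x0 y k : nonneg (isra H x0 y k) -> isra H x0 y k <> 0 ->
  D_LS H y (isra H x0 y k.+1) <= D_LS H y (isra H x0 y k).
Proof.
set x := isra H x0 y k => x_ge0 xN0.
pose G j : R := (H^T *m (H *m x)) j 0; pose a j : R := (H^T *m y) j 0.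
have G0 j : 0 < G j by exact: normal_mx_gt0.
pose s j := a j / G j - 1.
pose u i : R := (H *m x - y) i 0.
pose v i := \sum_j H i j * x j 0 * s j.
have step i : (H *m isra H x0 y k.+1 - y) i 0 = u i + v i.
  rewrite /u /v mxE [X in _ = X + _]mxE addrAC; congr (_ + _).
  rewrite !mxE -big_split; apply: eq_bigr => j _ /=.
  by rewrite israS /s -/(a j) -/(G j) -/x; ring.
rewrite /D_LS !norm2_sqr; under eq_bigr do rewrite step.
rewrite -subr_ge0 -sumrB.
have lin : \sum_i u i * v i = - \sum_j x j 0 * G j * s j ^+ 2.
  rewrite -sumrN.
  transitivity (\sum_i \sum_j u i * (H i j * x j 0 * s j)).
    by apply: eq_bigr => i _; rewrite mulr_sumr.
  rewrite exchange_big; apply: eq_bigr => j _ /=.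
  transitivity (x j 0 * s j * (G j - a j)).
    rewrite /G /a -[X in _ = _ * X]/(_ - _).
    have -> : (H^T *m (H *m x)) j 0 - (H^T *m y) j 0 = (H^T *m (H *m x - y)) j 0.
      by rewrite mulmxBr [RHS]mxE [X in _ = _ + X]mxE.
    rewrite [X in _ = _ * X]mxE mulr_sumr; apply: eq_bigr => i _.
    by rewrite [H^T _ _]mxE -/(u i); ring.
  have -> : a j = G j * (s j + 1) by rewrite /s subrK mulrC divfK ?gt_eqF.
  by ring.
have quad : \sum_i v i ^+ 2 <= \sum_j x j 0 * G j * s j ^+ 2.
  (* For each row [i] the weights are [H i j * x j 0], whose total is [(H x)_i]; exchanging the sums
     then turns [(H x)_i] into [G j]. *)
  apply: (@le_trans _ _
      (\sum_i (H *m x) i 0 * (\sum_j H i j * x j 0 * s j ^+ 2))).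
    apply: ler_sum => i _; rewrite mxE; apply: sqr_wmean_le => j.
    by rewrite mulr_ge0 ?x_ge0 // ltW.
  under eq_bigr do rewrite mulr_sumr.
  rewrite exchange_big; apply: ler_sum => j _ /=.
  rewrite /G [in leRHS]mxE mulr_sumr mulr_suml; apply: ler_sum => i _.
  by rewrite [H^T _ _]mxE le_eqVlt; apply/orP; left; apply/eqP; ring.
have -> : \sum_i (u i ^+ 2 - (u i + v i) ^+ 2) =
    - 2 * (\sum_i u i * v i) - \sum_i v i ^+ 2.
  rewrite mulr_sumr -sumrB; apply: eq_bigr => i _; ring.
have q0 : 0 <= \sum_j x j 0 * G j * s j ^+ 2.
  by apply: sumr_ge0 => j _; rewrite mulr_ge0 ?sqr_ge0 // mulr_ge0 ?x_ge0 // ltW.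
rewrite lin; lra.
Qed.

Lemma isra_D_LS_mono x0 y n m : nonneg x0 -> x0 <> 0 ->
  (forall j, 0 < (H^T *m y) j 0) -> (n <= m)%N ->
  D_LS H y (isra H x0 y m) <= D_LS H y (isra H x0 y n).
Proof.
move=> x0_ge0 x0N0 a0; elim: m => [|m IH]; first by rewrite leqn0 => /eqP ->.
rewrite leq_eqVlt => /predU1P[-> //|]; rewrite ltnS => /IH.
apply: le_trans; apply: isra_descent; last exact: isra_neq0.
by apply: isra_ge0 => // j; exact: ltW.
Qed.

(** Componentwise [(p + q)^2 <= 2 p^2 + 2 q^2], with gap [(p - q)^2]. It transfers a small
    discrepancy from the noisy data to the noise-free data. *)
Lemma D_LS_data_change y (z : 'cV[R]_N) x :
  D_LS H y x <= 2 * D_LS H z x + 2 * norm2 (z - y) ^+ 2.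
Proof.
rewrite /D_LS !norm2_sqr !mulr_sumr -big_split; apply: ler_sum => i _ /=.
rewrite mxE [(H *m x - z) _ _]mxE [(z - y) _ _]mxE.
set b := (H *m x) i 0; rewrite ![(- _ : 'cV_N) i 0]mxE.
rewrite -subr_ge0.
have -> : 2 * (b - z i 0) ^+ 2 + 2 * (z i 0 - y i 0) ^+ 2 - (b - y i 0) ^+ 2 =
   (b - 2 * z i 0 + y i 0) ^+ 2 by ring.
exact: sqr_ge0.
Qed.

End Positive.

(** * Regularization for fixed and for noisy data *)

Section MainTheorem.
Variables (R : realType) (N M : nat) (H : 'M[R]_(N, M)).
Hypotheses (N_gt0 : (0 < N)%N) (H_gt0 : forall i j, 0 < H i j).
Variables (tau : R) (tau_gt0 : 0 < tau).
Variables (x0 : 'cV[R]_M) (x0_ge0 : nonneg x0).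

Lemma isra_regularizes_fixed (y : 'cV[R]_N) (xhat : 'cV[R]_M) :
  constrained_LS H y xhat -> isra H x0 y k @[k --> \oo] --> xhat ->
  regularizes_fixed (constrained_ML H) (isra H x0) (CBR_selects H x0 tau) y xhat.
Proof.
move=> LSx cvg_xhat; split; first exact: constrained_LS_ML.
(* The default [0] is never taken for [sigma > 0], where a selected index exists. *)
pose k sigma := xget 0%N [set n | CBR_selects H x0 tau sigma y n].
have kP sigma : 0 < sigma -> CBR_selects H x0 tau sigma y (k sigma).
  move=> s0; apply: (xgetPex 0%N).
  exact: (CBR_selects_ex N_gt0 H_gt0 tau_gt0 s0 LSx.1 cvg_xhat).
(* In the second case the iteration is already constant, equal to [xhat], from [l] on;
   [never_stationary] excludes this case. *)
have late n : \forall sigma \near 0^'+, (n <= k sigma)%N \/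
    exists2 l, cbr_residual H y (isra H x0 y l) = 0 & (l <= k sigma)%N.
  have nP : \forall sigma \near 0^'+, forall l, (l < n)%N ->
      cbr_residual H y (isra H x0 y l) <> 0 -> ~ CBR H tau sigma y (isra H x0 y l).
    by apply: (@CBR_fails_before _ _ _ H x0 tau y (fun=> y)) => [|l]; exact: cvg_cst.
  near=> sigma; have s0 : 0 < sigma by [].
  have [nk|kn] := leqP n (k sigma); [by left|right].
  exists (k sigma) => //; apply: contrapT => rN0.
  by apply: (near nP sigma _ _ kn rN0) => //; exact: (kP _ s0).1.
exists k; split=> //.
  move=> U xU; have [n _ Un] := cvg_xhat U xU.
  apply: filterS (late n) => sigma [nk|[l r0 lk]]; first exact: Un.
  rewrite /= (cbr_residual_limit N_gt0 H_gt0 x0_ge0 r0 cvg_xhat lk).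
  exact: nbhs_singleton.
move=> ns; apply/cvgnyPge => n.
apply: filterS (late n) => sigma [//|[l r0 _]].
by case: (ns l); exact: cbr_residual_fixed.
Unshelve. all: by end_near. Qed.

Lemma isra_regularizes_noisy (x : 'cV[R]_M) (yd : R -> 'cV[R]_N) :
  nonneg x -> x <> 0 -> isra_converges H x0 (H *m x) ->
  (\forall sigma \near 0^'+, isra_converges H x0 (yd sigma)) ->
  yd sigma @[sigma --> 0^'+] --> H *m x ->
  regularizes_noisy (constrained_ML H) (isra H x0) (CBR_selects H x0 tau)
    yd (H *m x).
Proof.
set y := H *m x => x_ge0 xN0 [xhat [xhat_ge0 xhat_min] cvg_xhat] cvg_yd ydy.
(* The noise-free data are attained on the cone, so the minimal discrepancy is [0] and solutions are
   the nonnegative zeros of [D_LS H y]. *)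
have Dx : D_LS H y x = 0 by rewrite /D_LS subrr norm2_0 expr0n.
have Dxhat : D_LS H y xhat = 0.
  by apply/eqP; rewrite eq_le D_LS_ge0 -[leRHS]Dx xhat_min.
have y_gt0 i : 0 < y i 0 by exact: mulmx_gt0.
have a_gt0 j : 0 < (H^T *m y) j 0 by exact: trmx_mulmx_gt0.
(* Starting at [0], ISRA stays at [0], whose discrepancy is positive since [y > 0]; the limit could
   not be a minimizer. *)
have x0N0 : x0 <> 0.
  move=> x00; have xk0 k : isra H x0 y k = 0.
    by elim: k => [//|k IH]; apply/matrixP => j i; rewrite ord1 israS IH mxE mul0r.
  have xhat0 : xhat = 0.
    apply: (@cvg_unique _ (@norm_hausdorff R _) _ _ _ _ cvg_xhat).
    by apply: cvg_near_cst; exact: nearW.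
  move: Dxhat; rewrite xhat0 /D_LS norm2_sqr mulmx0 sub0r => /eqP.
  rewrite psumr_eq0 => [/allP|i _]; last exact: sqr_ge0.
  move=> /(_ (Ordinal N_gt0) (mem_index_enum _)) /=.
  by rewrite mxE sqrrN sqrf_eq0 gt_eqF.
have cvgx l : isra H x0 (yd sigma) l @[sigma --> 0^'+] --> isra H x0 y l.
  exact: cvg_isra.
pose k sigma := xget 0%N [set n | CBR_selects H x0 tau sigma (yd sigma) n].
have kP : \forall sigma \near 0^'+, CBR_selects H x0 tau sigma (yd sigma) (k sigma).
  near=> sigma; have s0 : 0 < sigma by [].
  apply: (xgetPex 0%N).
  have [xh [xh0 _] cvg_xh] : isra_converges H x0 (yd sigma) by near: sigma.
  exact: (CBR_selects_ex N_gt0 H_gt0 tau_gt0 s0 xh0 cvg_xh).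
have fails := CBR_fails_before tau _ ydy cvgx.
exists k; split=> //; last first.
  move=> ns; apply/cvgnyPge => n; near=> sigma.
  have kPs : CBR_selects H x0 tau sigma (yd sigma) (k sigma) by near: sigma.
  rewrite leqNgt; apply/negP => kn; apply: (near (fails n) sigma _ _ kn _ kPs.1) => //.
  by move=> r0; apply: (ns (k sigma)); exact: cbr_residual_fixed r0.
move=> U oU solU.
have cdata : (fun sigma => norm2 (yd sigma - y) ^+ 2) @ 0^'+ --> (0 : R).
  have : norm2 (yd sigma - y) ^+ 2 @[sigma --> 0^'+] --> norm2 (y - y) ^+ 2.
    by apply: cvg_norm2_sqr; apply: cvgB => //; exact: cvg_cst.
  by rewrite subrr norm2_0 expr0n.
(* The slack [1] gives a single box for all data near [y], since [H^T yd] is close to [H^T y] for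
   small [sigma]. *)
pose b j := x0 j 0 + ((H^T *m y) j 0 + 1) / \sum_i H i j ^+ 2.
have [||d d0 dU] := compact_sublevel (f := D_LS H y) (cV_box_compact (b := b)) oU.
- move=> z; apply: (@cvg_D_LS _ _ _ H _ (nbhs z) _ (fun=> y) id).
    exact: cvg_cst.
  exact: cvg_id.
- move=> z zb Dz; apply: solU; apply: constrained_LS_ML; split=> [j|z' _].
    by have /andP[] := zb j.
  exact: le_trans Dz (D_LS_ge0 _ _ _).
(* Both the noisy discrepancy and the squared data error are made less than [d / 4]; their doubles
   add up to less than [d]. *)
have d4 : 0 < d / 4 by rewrite divr_gt0.
have cvgD : D_LS H y (isra H x0 y n) @[n --> \oo] --> (0 : R).
  by rewrite -Dxhat; apply: cvg_D_LS => //; exact: cvg_cst.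
have [n _ Dn] := cvgr_lt _ cvgD _ d4.
have good l : D_LS H y (isra H x0 y l) < d / 4 ->
    \forall sigma \near 0^'+, D_LS H (yd sigma) (isra H x0 (yd sigma) l) < d / 4.
  by move=> Dl; apply: cvgr_lt Dl; exact: cvg_D_LS.
(* If the noise-free residual vanishes at [l], the noise-free iterate is [xhat], with discrepancy
   [0]; otherwise the test fails for small [sigma] and the implication is vacuous. *)
have early : \forall sigma \near 0^'+, forall l : 'I_n,
    CBR H tau sigma (yd sigma) (isra H x0 (yd sigma) l) ->
    D_LS H (yd sigma) (isra H x0 (yd sigma) l) < d / 4.
  apply: filter_forall => l.
  have [r0|rN0] := pselect (cbr_residual H y (isra H x0 y l) = 0).
    have /good : D_LS H y (isra H x0 y l) < d / 4.
      by rewrite (cbr_residual_limit N_gt0 H_gt0 x0_ge0 r0 cvg_xhat (leqnn l)) Dxhat.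
    by apply: filterS.
  by apply: filterS (CBR_fails_near tau ydy (cvgx l) rN0).
have aP : \forall sigma \near 0^'+, forall j,
    0 < (H^T *m yd sigma) j 0 < (H^T *m y) j 0 + 1.
  apply: filter_forall => j.
  have cvga : (H^T *m yd sigma) j 0 @[sigma --> 0^'+] --> (H^T *m y) j 0.
    by apply: cvg_mx_entry; exact: cvg_mulmx.
  near=> sigma; apply/andP; split; near: sigma.
    exact: cvgr_gt cvga _ (a_gt0 j).
  by apply: cvgr_lt cvga _ _; rewrite ltrDl.
near=> sigma.
have as_gt0 : forall j, 0 < (H^T *m yd sigma) j 0 < (H^T *m y) j 0 + 1.
  by near: sigma.
have as_gt0' j : 0 < (H^T *m yd sigma) j 0 by have /andP[] := as_gt0 j.
have as_ge0 j : 0 <= (H^T *m yd sigma) j 0 by exact: ltW.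
apply: dU.
  move=> j; apply/andP; split; first exact: isra_ge0.
  apply: le_trans (isra_bound N_gt0 H_gt0 x0_ge0 (k sigma) j as_ge0) _.
  rewrite lerD2l ler_wpM2r ?invr_ge0 ?ltW ?sqr_col_gt0 //.
  by have /andP[] := as_gt0 j.
have Dk : D_LS H (yd sigma) (isra H x0 (yd sigma) (k sigma)) < d / 4.
  (* An index past [n] inherits the bound at [n] by monotonicity; an earlier one passes the test and
     falls under [early]. *)
  have [nk|kn] := leqP n (k sigma).
    apply: le_lt_trans (isra_D_LS_mono N_gt0 H_gt0 x0_ge0 x0N0 as_gt0' nk) _.
    by near: sigma; apply: good; exact: Dn (leqnn n).
  have : forall l : 'I_n,
    CBR H tau sigma (yd sigma) (isra H x0 (yd sigma) l) ->
    D_LS H (yd sigma) (isra H x0 (yd sigma) l) < d / 4 by near: sigma.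
  move=> /(_ (Ordinal kn)); apply.
  suff : CBR_selects H x0 tau sigma (yd sigma) (k sigma) by case.
  by near: sigma.
have yd4 : norm2 (yd sigma - y) ^+ 2 < d / 4.
  by near: sigma; exact: cvgr_lt cdata _ d4.
apply: le_lt_trans (D_LS_data_change H y (yd sigma) _) _.
lra.
Unshelve. all: by end_near. Qed.

End MainTheorem.

Theorem theorem4p1 (R : realType) (N M : nat) (hN : (0 < N)%N) (hM : (0 < M)%N)
    (H : 'M[R]_(N, M)) (hH : forall i j, 0 < H i j)
    (tau : R) (htau : 0 < tau) (x0 : 'cV[R]_M) (hx0 : nonneg x0) :
  (forall (y : 'cV[R]_N) (xhat : 'cV[R]_M),
      constrained_LS H y xhat ->
      isra H x0 y k @[k --> \oo] --> xhat ->
      regularizes_fixed (constrained_ML H) (isra H x0)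
        (CBR_selects H x0 tau) y xhat) /\
  (forall (x : 'cV[R]_M) (yd : R -> 'cV[R]_N),
      nonneg x -> x <> 0 ->
      isra_converges H x0 (H *m x) ->
      (\forall sigma \near 0^'+, isra_converges H x0 (yd sigma)) ->
      yd sigma @[sigma --> 0^'+] --> H *m x ->
      regularizes_noisy (constrained_ML H) (isra H x0)
        (CBR_selects H x0 tau) yd (H *m x)).
Proof.
split=> [y xhat|x yd]; first exact: isra_regularizes_fixed.
exact: isra_regularizes_noisy.
Qed.
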